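(* Let $G$ be a finite simple undirected graph with vertices $v_1,\dots,v_n$, with $m$ edges, and with every vertex of degree at least $2$. Let $d(v_i)$ be the degree of $v_i$, and let $\chi(u,0)=\det(\mathbf{T}+u\mathbf{J})=d_0u^{2m}+d_1u^{2m-1}+\cdots+d_{2m}$ be the reduced Bartholdi zeta function of $G$. Then $$d_4=(-1)^m\Bigl(|\mathcal{V}|-3\sum_{\substack{1\le i\le n\\ d(v_i)\ge4}}\binom{d(v_i)}{4}\Bigr) =(-1)^m\Bigl(\binom{|\mathscr{C}|+|\mathscr{B}|}{2}-\sum_{\substack{1\le i\le n\\ d(v_i)\ge3}}\binom{C(v_i)}{2}-3\sum_{\substack{1\le i\le n\\ d(v_i)\ge4}}\binom{d(v_i)}{4}\Bigr).$$
   Context: Symmetric digraph: $\mathcal{D}(G)$ has vertex set $V(G)$ and arc set $\mathcal{E}(G)=\{(x,y),(y,x): xy\in E(G)\}$. For an arc $a=(x,y)$, $o(a)=x$, $t(a)=y$, $a^{-1}=(y,x)$. Label the $2m$ arcs $a_1,\dots,a_m,a_{m+1}=a_1^{-1},\dots,a_{2m}=a_m^{-1}$ (for an arbitrary orientation of the edges). Matrices ($2m\times2m$): $\mathbf{T}_{ij}=1$ if $t(a_i)=o(a_j)$ and $a_j\ne a_i^{-1}$, and $0$ otherwise; $\mathbf{J}_{ij}=1$ if $a_j=a_i^{-1}$, and $0$ otherwise. Vertex bridge: a sink star subgraph of $\mathcal{D}(G)$ with 2 leaves, i.e. a vertex $v$ (its sink node) together with two distinct arcs of $\mathcal{D}(G)$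 with terminus $v$. $\mathscr{B}$: the set of vertex bridges whose sink node has degree exactly $2$ in $G$; so $|\mathscr{B}|$ is the number of vertices of degree $2$. $\mathscr{C}$: the set of vertex bridges whose sink node has degree at least $3$. $C(v_i)=\binom{d(v_i)}{2}$ is the number of vertex bridges with sink node $v_i$ (for $d(v_i)\ge3$), so $|\mathscr{C}|=\sum_{d(v_i)\ge3}\binom{d(v_i)}{2}$. $\mathcal{V}$: the set of all unordered pairs of vertex bridges in $\mathcal{D}(G)$ having distinct sink nodes (the ''legal'' pairs). *)

(* Defs.v *)
From mathcomp Require Import all_boot all_order all_algebra.

Set Implicit Arguments.
Unset Strict Implicit.
Unset Printing Implicit Defensive.

Import GRing.Theory.
Local Open Scope ring_scope.

Record sgraph := SGraph {
  vertex :> finType;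
  adj : rel vertex;
  adj_sym : symmetric adj;
  adj_irrefl : irreflexive adj
}.

Definition deg (G : sgraph) (v : G) : nat := #|[set w | adj v w]|.

(* The arc (x, y) of the symmetric digraph is the pair (x, y) itself. *)
Definition org (G : sgraph) (p : G * G) : G := p.1.
Definition ter (G : sgraph) (p : G * G) : G := p.2.
Definition arc_inv (G : sgraph) (p : G * G) : G * G := (p.2, p.1).

Definition arcs (G : sgraph) : {set G * G} := [set p | adj p.1 p.2].

Definition edges (G : sgraph) : {set {set G}} :=
  [set [set p.1; p.2] | p in arcs G].

Definition nedges (G : sgraph) : nat := #|edges G|.

(* With 0-based indices, [a (lshift m i)] is the arc chosen for the i-th edge
   and [a (rshift m i)] is its inverse. *)
Record arc_labelling (G : sgraph) (a : 'I_(nedges G + nedges G) -> G * G) :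
    Prop := ArcLabelling {
  labelling_inj : injective a;
  labelling_codom : codom a =i arcs G;
  labelling_inv : forall i : 'I_(nedges G),
    a (rshift (nedges G) i) = arc_inv (a (lshift (nedges G) i))
}.

Lemma arc_labelling_exists (G : sgraph) :
  exists a : 'I_(nedges G + nedges G) -> G * G, arc_labelling a.
Proof.
have hp (i : 'I_(nedges G)) :
    exists p, (p \in arcs G) && ([set p.1; p.2] == enum_val i).
  have /imsetP[p pA ->] := enum_valP i.
  by exists p; rewrite pA eqxx.
pose b i := xchoose (hp i).
have bA i : b i \in arcs G by case/andP: (xchooseP (hp i)).
have bE i : [set (b i).1; (b i).2] = enum_val i.
  by case/andP: (xchooseP (hp i)) => _ /eqP.
have b_inj i j : [set (b i).1; (b i).2] = [set (b j).1; (b j).2] -> i = j.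
  by rewrite !bE => /enum_val_inj.
have bN i j : b i <> arc_inv (b j).
  move=> eq_ij; have eij : i = j by apply: b_inj; rewrite eq_ij setUC.
  move: eq_ij (bA i); rewrite -eij inE; case: (b i) => x y [-> _] /=.
  by rewrite adj_irrefl.
pose a (k : 'I_(nedges G + nedges G)) :=
  match split k with inl i => b i | inr i => arc_inv (b i) end.
have al i : a (lshift _ i) = b i by rewrite /a (unsplitK (inl i)).
have ar i : a (rshift _ i) = arc_inv (b i) by rewrite /a (unsplitK (inr i)).
exists a; split=> [k l|p|i]; last by rewrite ar al.
  case: (splitP k) => i ki; case: (splitP l) => j lj.
  - have -> : k = lshift _ i by apply: val_inj.
    have -> : l = lshift _ j by apply: val_inj.
    by rewrite !al => eq_ij; rewrite (b_inj i j) ?eq_ij.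
  - have -> : k = lshift _ i by apply: val_inj.
    have -> : l = rshift _ j by apply: val_inj.
    by rewrite al ar => eq_ij; case: (bN _ _ eq_ij).
  - have -> : k = rshift _ i by apply: val_inj.
    have -> : l = lshift _ j by apply: val_inj.
    by rewrite al ar => eq_ij; case: (bN _ _ (esym eq_ij)).
  - have -> : k = rshift _ i by apply: val_inj.
    have -> : l = rshift _ j by apply: val_inj.
    by rewrite !ar => -[e2 e1]; rewrite (b_inj i j) ?e1 ?e2.
apply/codomP/idP => [[k ->]|pA].
  case: (splitP k) => i ki.
    by have -> : k = lshift _ i by [apply: val_inj]; rewrite al.
  have -> : k = rshift _ i by apply: val_inj.
  by rewrite ar inE adj_sym; have := bA i; rewrite inE.
have pE : [set p.1; p.2] \in edges G by apply/imsetP; exists p.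
pose i := enum_rank_in pE [set p.1; p.2].
have bi : [set (b i).1; (b i).2] = [set p.1; p.2] by rewrite bE enum_rankK_in.
have n12 : p.1 != p.2.
  by apply: contraTneq pA => e12; rewrite inE e12 adj_irrefl.
have : p.1 \in [set (b i).1; (b i).2] by rewrite bi set21.
have : p.2 \in [set (b i).1; (b i).2] by rewrite bi set22.
rewrite !inE => /orP[]/eqP e2 /orP[]/eqP e1.
- by rewrite e1 e2 eqxx in n12.
- exists (rshift _ i); rewrite ar.
  by apply: injective_projections; rewrite ?e1 ?e2.
- exists (lshift _ i); rewrite al.
  by apply: injective_projections; rewrite ?e1 ?e2.
- by rewrite e1 e2 eqxx in n12.
Qed.

Definition Tmx (G : sgraph) (a : 'I_(nedges G + nedges G) -> G * G) :
    'M[int]_(nedges G + nedges G) :=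
  \matrix_(i, j) ((ter (a i) == org (a j)) && (a j != arc_inv (a i)))%:R.

Definition Jmx (G : sgraph) (a : 'I_(nedges G + nedges G) -> G * G) :
    'M[int]_(nedges G + nedges G) :=
  \matrix_(i, j) (a j == arc_inv (a i))%:R.

(* chi(u, 0) as a polynomial in u = 'X. *)
Definition reduced_bartholdi (G : sgraph)
    (a : 'I_(nedges G + nedges G) -> G * G) : {poly int} :=
  \det (map_mx polyC (Tmx a) + 'X *: map_mx polyC (Jmx a)).

(* d_k is the coefficient of u^(2m - k); the test guards against truncated
   subtraction when k > 2m, which for k = 4 and minimum degree at least 2
   happens only for the graph without vertices. *)
Definition bartholdi_coef (G : sgraph)
    (a : 'I_(nedges G + nedges G) -> G * G) (k : nat) : int :=
  if (k <= 2 * nedges G)%N then (reduced_bartholdi a)`_(2 * nedges G - k)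
  else 0.

(* A vertex bridge is a sink node together with the set of its two arcs. *)
Definition vertex_bridges (G : sgraph) : {set G * {set G * G}} :=
  [set b : G * {set G * G} |
     (b.2 \subset [set p in arcs G | ter p == b.1]) && (#|b.2| == 2%N)].

Definition sink (G : sgraph) (b : G * {set G * G}) : G := b.1.

Definition bridgesB (G : sgraph) : {set G * {set G * G}} :=
  [set b in vertex_bridges G | deg (sink b) == 2%N].

Definition bridgesC (G : sgraph) : {set G * {set G * G}} :=
  [set b in vertex_bridges G | (3 <= deg (sink b))%N].

Definition bridge_count (G : sgraph) (v : G) : nat :=
  #|[set b in vertex_bridges G | sink b == v]|.

Lemma bridge_countE (G : sgraph) (v : G) : bridge_count v = 'C(deg v, 2).
Proof.
have pair_inj : injective (fun w : G => (w, v)) by move=> x y [].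
have -> : deg v = #|[set p in arcs G | ter p == v]|.
  rewrite /deg -(card_imset [set w | adj v w] pair_inj).
  apply: eq_card => -[x y]; rewrite !inE /=.
  apply/imsetP/andP => [[w]|[xy /eqP yv]].
    by rewrite inE adj_sym => vw [-> ->]; rewrite eqxx.
  by exists x; rewrite ?inE -?yv // adj_sym.
have sink_inj : injective (fun A : {set G * G} => (v, A)) by move=> x y [].
rewrite -cards_draws -(card_imset _ sink_inj).
apply: eq_card => -[x A]; rewrite !inE /sink /=.
apply/andP/imsetP => [[/andP[sA cA] /eqP xv]|[B]].
  by exists A; rewrite ?inE -?xv ?sA.
by rewrite inE => /andP[sB cB] [-> ->]; rewrite sB cB eqxx.
Qed.

Definition legal_pairs (G : sgraph) : {set {set G * {set G * G}}} :=
  [set [set b; c] | b in vertex_bridges G,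
                    c in vertex_bridges G & sink b != sink c].

(* Main.v *)
Require Import Defs.
From mathcomp Require Import all_boot all_order all_algebra.
From mathcomp Require Import ring.

(** The determinant factors completely over the vertices of [G], and [d_4] is
    then read off the factors.

    Let [J] be the arc-reversal matrix, [B] the arc-by-vertex matrix recording
    the terminus of each arc, and [z = u - 1].  Two arcs are consecutive when
    the terminus of the first is the terminus of the inverse of the second, so
    [T + J = B B^T J], hence [T + u J = (B B^T + z I) J]
    (bartholdi_mx_factor).  As [J] is a product of [m] transpositions, its
    determinant is [(-1)^m].  Exchanging the two factors of [B B^T]
    (det_scalar_addM) turns the other determinant into that of
    [B^T B + z I], which is diagonal with entries [z + d(v)]; after cancelling
    powers of [z] this gives (reduced_bartholdiE)
      [chi(u, 0) = (-1)^m \prod_v (u - 1)^(d(v) - 1) (u + d(v) - 1)].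

    The numbers [d_k] count down from the leading coefficient, so they are the
    coefficients of the reciprocal polynomial, the product over [v] of
    [(1 - u)^(d(v) - 1) (1 + (d(v) - 1) u)].  In one factor the coefficient
    of [u^k] is [(-1)^(k-1) (k - 1) 'C(d(v), k)] (coef_vertex_factor): it is
    [1], [0], [- 'C(d(v), 2)] for [k = 0, 1, 2], and [- 3 'C(d(v), 4)] for
    [k = 4].  Since the linear terms vanish, the coefficient of [u^4] in the
    product receives [- 3 'C(d(v), 4)] from each single vertex and
    ['C(d(v), 2) 'C(d(w), 2)] from each pair of vertices.  The pairs add up to
    the number of pairs of vertex bridges with distinct sinks, which is the
    number of all pairs of vertex bridges minus that of the pairs with a common
    sink (card_pairs_distinct_image). *)

Set Implicit Arguments.
Unset Strict Implicit.
Unset Printing Implicit Defensive.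

Import GRing.Theory.
Local Open Scope ring_scope.

(** * Reciprocal polynomials *)

(** The polynomial [u^n p(1/u)], provided that [p] has degree at most [n].  The
    degree bound is a parameter rather than read off [p], which makes the
    operation linear. *)
Definition reciprocal (R : nzRingType) (n : nat) (p : {poly R}) : {poly R} :=
  \poly_(i < n.+1) p`_(n - i).

Lemma reciprocalD (R : nzRingType) (n : nat) (p q : {poly R}) :
  reciprocal n (p + q) = reciprocal n p + reciprocal n q.
Proof.
by apply/polyP=> k; rewrite coefD !coef_poly coefD; case: ifP; rewrite ?addr0.
Qed.

Lemma reciprocalZ (R : nzRingType) (n : nat) (c : R) (p : {poly R}) :
  reciprocal n (c *: p) = c *: reciprocal n p.
Proof.
by apply/polyP=> k; rewrite coefZ !coef_poly coefZ; case: ifP; rewrite ?mulr0.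
Qed.

Lemma reciprocal_sum (R : nzRingType) (n : nat) (I : Type) (r : seq I)
    (F : I -> {poly R}) :
  reciprocal n (\sum_(i <- r) F i) = \sum_(i <- r) reciprocal n (F i).
Proof.
apply: big_morph => [p q|]; first exact: reciprocalD.
by rewrite -[0](scale0r 0) reciprocalZ !scale0r.
Qed.

Lemma reciprocalXn (R : comNzRingType) (n k : nat) :
  (k <= n)%N -> reciprocal n 'X^k = 'X^(n - k) :> {poly R}.
Proof.
move=> le_kn; apply/polyP=> i; rewrite coef_poly !coefXn ltnS.
case: leqP => [le_in|lt_ni]; last first.
  by rewrite gtn_eqF // (leq_ltn_trans (leq_subr _ _)).
by rewrite -(eqn_add2r i) subnK // -(eqn_add2r k i) subnK // eq_sym addnC.
Qed.

Lemma polyE_leq (R : comNzRingType) (n : nat) (p : {poly R}) :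
  (size p <= n)%N -> p = \sum_(i < n) p`_i *: 'X^i.
Proof. by move/take_poly_id => {1}<-; rewrite /take_poly poly_def. Qed.

(** Both sides are bilinear, so it suffices to compare them on monomials. *)
Lemma reciprocalM (R : comNzRingType) (m n : nat) (p q : {poly R}) :
  (size p <= m.+1)%N -> (size q <= n.+1)%N ->
  reciprocal (m + n) (p * q) = reciprocal m p * reciprocal n q.
Proof.
move=> /polyE_leq-> /polyE_leq->.
rewrite mulr_suml !reciprocal_sum mulr_suml; apply: eq_bigr => i _.
rewrite !mulr_sumr reciprocal_sum; apply: eq_bigr => j _.
rewrite -!(scalerAl, scalerAr) !reciprocalZ -!(scalerAl, scalerAr).
have lei : (i <= m)%N by rewrite -ltnS.
have lej : (j <= n)%N by rewrite -ltnS.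
rewrite (reciprocalXn _ lei) (reciprocalXn _ lej).
rewrite -(exprD 'X i j) -(exprD 'X (m - i) (n - j)) reciprocalXn ?leq_add //.
congr (_ *: (_ *: 'X^_)).
by rewrite addnBA // addnBAC // subnDA.
Qed.

Lemma reciprocal_prod (R : comNzRingType) (I : Type) (r : seq I) (n : I -> nat)
    (F : I -> {poly R}) :
  (forall i, (size (F i) <= (n i).+1)%N) ->
  reciprocal (\sum_(i <- r) n i) (\prod_(i <- r) F i)
    = \prod_(i <- r) reciprocal (n i) (F i).
Proof.
move=> szF; suff [] : (size (\prod_(i <- r) F i)%R <= (\sum_(i <- r) n i).+1)%N
    /\ reciprocal (\sum_(i <- r) n i) (\prod_(i <- r) F i)
       = \prod_(i <- r) reciprocal (n i) (F i) by [].
elim: r => [|i r [szr IHr]]; last first.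
  rewrite !big_cons reciprocalM // IHr; split=> //.
  apply: leq_trans (size_polyMleq _ _) _.
  by rewrite -subn1 leq_subLR add1n -addSn -addnS leq_add.
by rewrite !big_nil size_poly1 (@reciprocalXn _ 0 0).
Qed.

Lemma reciprocal_XaddC (R : comNzRingType) (c : R) :
  reciprocal 1 ('X + c%:P) = 1 + c *: 'X.
Proof.
have e : 'X + c%:P = 'X^1 + c *: 'X^0 by rewrite alg_polyC.
by rewrite e reciprocalD reciprocalZ !reciprocalXn.
Qed.

Lemma reciprocal_XaddC_exp (R : comNzRingType) (c : R) (k : nat) :
  reciprocal k (('X + c%:P) ^+ k) = (1 + c *: 'X) ^+ k.
Proof.
have := @reciprocal_prod R _ (index_enum 'I_k) (fun=> 1%N) (fun=> 'X + c%:P).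
rewrite sum1_card !prodr_const card_ord reciprocal_XaddC; apply=> _.
by rewrite size_XaddC.
Qed.

(** * The factor of a vertex of degree [n.+1] *)

Lemma size_vertex_factor (R : comNzRingType) (n : nat) :
  (size (('X - 1) ^+ n * ('X + n%:R) : {poly R})%R <= n.+2)%N.
Proof.
apply: leq_trans (size_polyMleq _ _) _.
by rewrite -polyC1 -polyC_natr size_exp_XsubC size_XaddC addn2.
Qed.

Lemma reciprocal_vertex_factor (R : comNzRingType) (n : nat) :
  reciprocal n.+1 (('X - 1) ^+ n * ('X + n%:R))
    = (1 - 'X) ^+ n * (1 + n%:R *: 'X) :> {poly R}.
Proof.
have eN : 'X - 1 = 'X + (-1)%:P :> {poly R} by rewrite polyCN.
rewrite eN -polyC_natr -addn1 reciprocalM.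
- by rewrite reciprocal_XaddC_exp reciprocal_XaddC scaleN1r.
- by rewrite polyCN size_exp_XsubC.
- by rewrite size_XaddC.
Qed.

(** The polynomial is [\det (1 + u A)] for the adjacency matrix [A] of the
    complete graph on [n.+1] vertices, so the coefficient sums the principal
    minors of [A] of order [k.+1], each of which is [(-1)^k k].  The proof
    expands the power by the binomial theorem instead. *)
Lemma coef_vertex_factor (n k : nat) :
  ((1 - 'X) ^+ n * (1 + n%:R *: 'X) : {poly int})`_k.+1
    = (-1) ^+ k * (k%:R * 'C(n.+1, k.+1)%:R).
Proof.
have cf j : ((1 - 'X) ^+ n : {poly int})`_j = (-1) ^+ j * 'C(n, j)%:R.
  rewrite exprBn coef_sum.
  under eq_bigr => i _ do rewrite expr1n mulr1 -mulrnAr -polyCN -polyC_exp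
    mul_polyC coefZ coefMn coefXn.
  case: (leqP j n) => [lejn|ltnj]; last first.
    rewrite bin_small // mulr0 big1 // => i _.
    by rewrite gtn_eqF ?mul0rn ?mulr0 // (leq_trans _ ltnj).
  rewrite (bigD1 (Ordinal (lejn : j < n.+1)%N)) //= eqxx big1 ?addr0 //.
  move=> i; rewrite -val_eqE /= eq_sym => /negbTE ->.
  by rewrite mul0rn mulr0.
rewrite mulrDr mulr1 coefD -scalerAr coefZ coefMX /= !cf.
(* Pascal's rule together with the absorption identity. *)
have e : n%:R * 'C(n, k)%:R - 'C(n, k.+1)%:R = k%:R * 'C(n.+1, k.+1)%:R :> int.
  have := congr1 (fun x => x%:R : int) (mul_bin_diag n.+1 k).
  rewrite /= !natrM binS !natrD -!natr1 => /eqP.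
  rewrite -subr_eq0 => /eqP e; apply/eqP; rewrite -subr_eq0 -e.
  by apply/eqP; ring.
by rewrite -e exprS; ring.
Qed.

Lemma bin2D (m n : nat) : 'C(m + n, 2) = ('C(m, 2) + 'C(n, 2) + m * n)%N.
Proof.
elim: m => [|m IH]; first by rewrite add0n addn0.
by rewrite addSn !binS IH !bin1; ring.
Qed.

(** Writing the pair contributions to the coefficient of degree 4 as a binomial
    coefficient of [\sum n i] lets the product be built one factor at a time:
    bin2D is exactly the cross term [n i * n j].  The vanishing linear
    coefficients exclude every other way to split the degree 4. *)
Lemma coef4_prod (I : Type) (r : seq I) (F : I -> {poly int}) (n : I -> nat)
    (b : I -> int) :
    (forall i, [/\ (F i)`_0 = 1, (F i)`_1 = 0, (F i)`_2 = - (n i)%:R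
                 & (F i)`_4 = b i]) ->
  (\prod_(i <- r) F i)`_4
    = 'C(\sum_(i <- r) n i, 2)%:R + \sum_(i <- r) (b i - 'C(n i, 2)%:R).
Proof.
move=> hF; suff [] : [/\ (\prod_(i <- r) F i)`_0 = 1,
    (\prod_(i <- r) F i)`_1 = 0,
    (\prod_(i <- r) F i)`_2 = - (\sum_(i <- r) n i)%N%:R
  & (\prod_(i <- r) F i)`_4
    = 'C(\sum_(i <- r) n i, 2)%:R + \sum_(i <- r) (b i - 'C(n i, 2)%:R)] by [].
elim: r => [|i r [P0 P1 P2 P4]]; first by rewrite !big_nil !coef1.
have [F0 F1 F2 F4] := hF i; rewrite !big_cons bin2D !natrD natrM.
by split; rewrite coefM !big_ord_recr big_ord0 /= ?P0 ?P1 ?P2 ?P4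
  ?F0 ?F1 ?F2 ?F4; ring.
Qed.

(** * Pairs of elements with distinct images *)

(** A two-element subset whose points have equal images lies in exactly one
    fibre of [f]. *)
Lemma card_pairs_distinct_image (T V : finType) (f : T -> V) (X : {set T}) :
  (#|[set [set x; y] | x in X, y in X & f x != f y]|
   + \sum_v 'C(#|[set x in X | f x == v]|, 2))%N = 'C(#|X|, 2).
Proof.
set L := (X in (#|pred_of_set X| + _)%N).
pose P := [set A : {set T} | (A \subset X) && (#|A| == 2%N)].
have sLP : L \subset P.
  apply/subsetP=> A /imset2P[x y xX]; rewrite inE => /andP[yX fxy] ->.
  rewrite inE cards2 subUset !sub1set xX yX /=.
  by have -> : x != y by apply: contraNneq fxy => ->.
rewrite -[RHS]cards_draws -/P -(cardsID L P) (setIidPr sLP); congr addn.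
have fib A : A \in P :\: L ->
    (\sum_v (A \subset [set x in X | f x == v]))%N = 1%N.
  rewrite !inE => /and3P[AL AX /cards2P[x [y [xy eA]]]].
  move: AX; rewrite {A}eA subUset !sub1set in AL * => /andP[xX yX].
  have fxy : f x = f y.
    apply/eqP; apply: contraNT AL => fxy.
    by apply/imset2P; exists x y => //; rewrite inE yX.
  rewrite (bigD1 (f x)) //= subUset !sub1set !inE xX yX -fxy eqxx big1 // => v.
  by rewrite subUset !sub1set !inE eq_sym xX => /negbTE->.
rewrite -[RHS]sum1_card -(eq_bigr _ fib) exchange_big /=.
apply: eq_bigr => v _; rewrite -cards_draws -sum1_card -big_mkcondr /=.
apply: eq_bigl => A; rewrite !inE andbC -andbA.
case: (boolP (A \subset _)) => sA; rewrite ?andbF // !andbT.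
suff -> : A \in L = false.
  by rewrite (subset_trans sA) //; apply/subsetP=> x; rewrite inE => /andP[].
apply/imset2P=> -[x y xX]; rewrite inE => /andP[yX /negP fxy] eA.
move: sA; rewrite eA subUset !sub1set !inE xX yX => /andP[/eqP fx /eqP fy].
by case: fxy; rewrite fx fy.
Qed.

(** * Two determinants *)

(** Elementary block operations reduce the matrix to a triangular one with
    diagonal blocks [1] and [-1]. *)
Lemma det_block_swap (R : comNzRingType) (m : nat) :
  \det (block_mx 0 1%:M 1%:M 0 : 'M[R]_(m + m)) = (-1) ^+ m.
Proof.
have e : block_mx 1%:M 0 (- 1%:M) 1%:M *m
      (block_mx 0 1%:M 1%:M 0 *m block_mx 1%:M 0 1%:M 1%:M)
    = block_mx 1%:M 1%:M 0 (- 1%:M) :> 'M[R]_(m + m).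
  rewrite !mulmx_block !(mulmx0, mul0mx, mulmx1, mul1mx, addr0, add0r).
  by rewrite addNr.
have := congr1 determinant e.
rewrite !det_mulmx !det_lblock det_ublock !det1 !mul1r !mulr1 => ->.
by rewrite -scaleN1r scale_scalar_mx mulr1 det_scalar.
Qed.

(** Sylvester's identity, in a form valid over any commutative ring: both sides
    are determinants of products of the block matrix [z, -A; B, 1] with a
    triangular one. *)
Lemma det_scalar_addM (R : comNzRingType) (m n : nat) (z : R)
    (A : 'M_(m, n)) (B : 'M_(n, m)) :
  z ^+ n * \det (A *m B + z%:M) = z ^+ m * \det (B *m A + z%:M).
Proof.
pose M := block_mx z%:M (- A) B 1%:M.
have eAB : M *m block_mx 1%:M 0 (- B) 1%:M
    = block_mx (A *m B + z%:M) (- A) 0 1%:M.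
  rewrite mulmx_block !(mulmx0, mul0mx, mulmx1, mul1mx, addr0, add0r).
  by rewrite mulNmx mulmxN opprK addrN addrC.
have eBA : M *m block_mx 1%:M A 0 z%:M = block_mx z%:M 0 B (B *m A + z%:M).
  rewrite mulmx_block !(mulmx0, mul0mx, mulmx1, mul1mx, addr0, add0r).
  by rewrite mul_mx_scalar mul_scalar_mx scalerN addrN.
have := congr1 determinant eAB; have := congr1 determinant eBA.
rewrite !det_mulmx !det_lblock !det_ublock !det1 !det_scalar !mul1r !mulr1.
by move=> eB <-; rewrite mulrC eB.
Qed.

(** * Factorization of the reduced Bartholdi zeta function *)

Section Zeta.
Variables (G : sgraph) (a : 'I_(nedges G + nedges G) -> G * G).
Hypothesis ha : arc_labelling a.

Lemma arc_invK : involutive (@arc_inv G).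
Proof. by case. Qed.

Lemma card_arcs_into (v : G) : #|[set k | ter (a k) == v]| = deg v.
Proof.
rewrite /deg -(@card_in_imset _ _ (fun k => org (a k))); last first.
  move=> k l; rewrite !inE => /eqP tk /eqP tl ok; apply: (labelling_inj ha).
  by apply: injective_projections; rewrite // [LHS]tk [RHS]tl.
apply: eq_card => w; rewrite inE; apply/imsetP/idP => [[k]|vw].
  rewrite inE => /eqP <- ->; have := codom_f a k.
  by rewrite (labelling_codom ha) inE adj_sym.
have: (w, v) \in arcs G by rewrite inE /= adj_sym.
rewrite -(labelling_codom ha) => /codomP[k ek].
by exists k; rewrite ?inE -ek.
Qed.

Lemma sum_deg : (\sum_(v : G) deg v = nedges G + nedges G)%N.
Proof.
rewrite -[RHS]card_ord -sum1_card.
rewrite (partition_big (fun k => ter (a k)) xpredT) //.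
by apply: eq_bigr => v _; rewrite sum1_card -card_arcs_into cardsE.
Qed.

Lemma inverse_index j : exists j', a j' = arc_inv (a j).
Proof.
have: arc_inv (a j) \in arcs G.
  by have := codom_f a j; rewrite (labelling_codom ha) !inE adj_sym.
by rewrite -(labelling_codom ha) => /codomP[j' ->]; exists j'.
Qed.

Lemma Jmx_block : Jmx a = block_mx 0 1%:M 1%:M 0.
Proof.
have lr i j : a (lshift _ i) != arc_inv (a (lshift _ j)).
  rewrite -(labelling_inv ha) (inj_eq (labelling_inj ha)).
  by rewrite eq_lrshift.
apply/matrixP=> i j; rewrite mxE.
case: (split_ordP i) => i' ->; case: (split_ordP j) => j' ->.
- by rewrite block_mxEul mxE (negbTE (lr _ _)).
- rewrite block_mxEur mxE -(labelling_inv ha) (inj_eq (labelling_inj ha)).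
  by rewrite eq_rshift eq_sym.
- rewrite block_mxEdl mxE (labelling_inv ha) arc_invK.
  by rewrite (inj_eq (labelling_inj ha)) eq_lshift eq_sym.
- rewrite block_mxEdr mxE !(labelling_inv ha) arc_invK.
  by rewrite eq_sym (negbTE (lr _ _)).
Qed.

(** The entries are polynomials because the determinant identity of [B B^T] and
    [B^T B] is applied with [z = 'X - 1]. *)
Definition terminus_mx : 'M[{poly int}]_(nedges G + nedges G, #|G|) :=
  \matrix_(k, v) (ter (a k) == enum_val v)%:R.

Lemma terminus_mxM i j :
  (terminus_mx *m terminus_mx^T) i j = (ter (a i) == ter (a j))%:R.
Proof.
rewrite mxE (bigD1 (enum_rank (ter (a i)))) //= !mxE enum_rankK eqxx mul1r.
rewrite big1 ?addr0 1?eq_sym // => v; rewrite !mxE => ne.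
case: eqVneq => [e|_]; last by rewrite mul0r.
by rewrite e enum_valK eqxx in ne.
Qed.

Lemma terminus_mx_trM :
  terminus_mx^T *m terminus_mx = diag_mx (\row_v (deg (enum_val v))%:R).
Proof.
apply/matrixP=> v w; rewrite !mxE -card_arcs_into -sum1_card.
case: eqVneq => [<-|nvw].
  rewrite mulr1n natr_sum [RHS]big_mkcond; apply: eq_bigr => k _.
  by rewrite !mxE inE -natrM mulnb andbb; case: ifP.
rewrite mulr0n big1 // => k _; rewrite !mxE -natrM mulnb.
by case: eqP => // ->; rewrite (inj_eq enum_val_inj) (negbTE nvw).
Qed.

(** The entry [i, j] of [B B^T J] is the entry [i, j'] of [B B^T], where [a j']
    is the inverse of [a j]: it tests whether [a i] ends where [a j] starts.
    This is [T + J], because [T] leaves out precisely the backtracking pairs. *)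
Lemma bartholdi_mx_factor :
  map_mx polyC (Tmx a) + 'X *: map_mx polyC (Jmx a)
    = (terminus_mx *m terminus_mx^T + ('X - 1)%:M) *m map_mx polyC (Jmx a).
Proof.
apply/matrixP=> i j; have [j' ej'] := inverse_index j.
have Jk k : (a j == arc_inv (a k)) = (k == j').
  by rewrite -(inj_eq (can_inj arc_invK)) arc_invK -ej' eq_sym
    (inj_eq (labelling_inj ha)).
rewrite [RHS]mxE (bigD1 j') //= big1 ?addr0; last first.
  by move=> k nk; rewrite !mxE Jk (negbTE nk) rmorph0 mulr0.
rewrite [in RHS]mxE terminus_mxM !mxE !Jk eqxx ej'.
rewrite !rmorph_nat mulr1 /ter /org /arc_inv /=.
case: (eqVneq i j') => [->|ne]; last by rewrite andbT mulr0 mulr0n !addr0.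
by rewrite ej' /= eqxx /= mulr1n mulr1 rmorph0; ring.
Qed.

(** For [k > 2m] both sides vanish: the truncation in reciprocal does what the
    guard in bartholdi_coef does. *)
Lemma bartholdi_coefE (k : nat) :
  bartholdi_coef a k = (reciprocal (2 * nedges G) (reduced_bartholdi a))`_k.
Proof. by rewrite /bartholdi_coef coef_poly ltnS. Qed.

Hypothesis deg_gt0 : forall v : G, (0 < deg v)%N.

(** Positive degrees are what allows one power of [z] per vertex to be cancelled
    from the identity of det_scalar_addM. *)
Lemma reduced_bartholdiE :
  reduced_bartholdi a = (-1) ^+ nedges G *
    \prod_(v : G) (('X - 1) ^+ (deg v).-1 * ('X + (deg v).-1%:R)).
Proof.
rewrite /reduced_bartholdi bartholdi_mx_factor det_mulmx det_map_mx Jmx_block.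
rewrite det_block_swap mulrC rmorph_sign; congr (_ * _).
have z_neq0 : ('X - 1) ^+ #|G| != 0 :> {poly int}.
  by rewrite expf_neq0 // -polyC1 polyXsubC_eq0.
apply: (mulfI z_neq0); rewrite det_scalar_addM terminus_mx_trM.
have -> : diag_mx (\row_v (deg (enum_val v))%:R) + ('X - 1)%:M
    = diag_mx (\row_v ('X + (deg (enum_val v)).-1%:R)) :> 'M[{poly int}]_#|G|.
  apply/matrixP=> v w; rewrite !mxE -mulrnDl; congr (_ *+ _).
  by rewrite -{1}(prednK (deg_gt0 (enum_val v))) -natr1; ring.
rewrite det_diag big_split /= mulrA; congr (_ * _).
  rewrite -sum_deg -prodrXr -prodr_const -big_split /=.
  by apply: eq_bigr => v _; rewrite -exprS prednK.
by rewrite [RHS](big_enum_val (A := predT)); apply: eq_bigr => v _; rewrite mxE.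
Qed.

Lemma bartholdi_coef4E :
  bartholdi_coef a 4 = (-1) ^+ nedges G *
    ('C(\sum_(v : G) 'C(deg v, 2), 2)%:R
     - \sum_(v : G) 'C('C(deg v, 2), 2)%:R
     - 3 * \sum_(v : G) 'C(deg v, 4)%:R).
Proof.
have polyC_sign : (-1) ^+ nedges G = ((-1) ^+ nedges G)%:P :> {poly int}.
  by rewrite rmorph_sign.
rewrite bartholdi_coefE reduced_bartholdiE polyC_sign mul_polyC reciprocalZ.
rewrite coefZ mul2n -addnn -sum_deg reciprocal_prod => [|v]; last first.
  rewrite -{3}(prednK (deg_gt0 v)); apply: size_vertex_factor.
congr (_ * _).
rewrite (@coef4_prod _ _ _ (fun v => 'C(deg v, 2))
  (fun v => - (3 * 'C(deg v, 4)%:R))) => [|v].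
  by rewrite sumrB sumrN -mulr_sumr; ring.
case: (deg v) (deg_gt0 v) => // d _; rewrite reciprocal_vertex_factor.
rewrite !coef_vertex_factor; split; [|by ring..].
by rewrite -horner_coef0 !hornerE expr1n.
Qed.

End Zeta.

(** * Counting vertex bridges *)

Lemma card_vertex_bridges (G : sgraph) :
  #|vertex_bridges G| = (\sum_(v : G) 'C(deg v, 2))%N.
Proof.
rewrite -sum1_card (partition_big (@sink G) xpredT) //.
apply: eq_bigr => v _; rewrite -bridge_countE /bridge_count -sum1_card.
by apply: eq_bigl => b; rewrite inE.
Qed.

Lemma card_legal_pairs (G : sgraph) :
  #|legal_pairs G|%:R = 'C(#|vertex_bridges G|, 2)%:R
    - \sum_(v : G) 'C(bridge_count v, 2)%:R :> int.
Proof.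
rewrite -(card_pairs_distinct_image (@sink G) (vertex_bridges G)).
by rewrite natrD natr_sum addrK.
Qed.

Lemma card_bridgesCB (G : sgraph) :
  (forall v : G, (2 <= deg v)%N) ->
  (#|bridgesC G| + #|bridgesB G|)%N = #|vertex_bridges G|.
Proof.
move=> hdeg; rewrite -(cardsID (bridgesC G) (vertex_bridges G)).
congr (_ + _)%N; apply: eq_card => b; rewrite !inE.
  by rewrite andbA andbb.
rewrite [deg _ == _]eqn_leq hdeg andbT leqNgt.
by case: (2 < _)%N; rewrite ?andbF !andbT ?andNb.
Qed.

(** * The coefficient [d_4] *)

Theorem theorem4p10 (G : sgraph) (a : 'I_(nedges G + nedges G) -> G * G)
    (ha : arc_labelling a) (hdeg : forall v : G, (2 <= deg v)%N) :
  bartholdi_coef a 4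
    = (-1) ^+ nedges G *
      (#|legal_pairs G|%:Z
       - 3 * \sum_(v : G | (4 <= deg v)%N) 'C(deg v, 4)%:Z)
  /\
  (-1) ^+ nedges G *
      (#|legal_pairs G|%:Z
       - 3 * \sum_(v : G | (4 <= deg v)%N) 'C(deg v, 4)%:Z)
    = (-1) ^+ nedges G *
      ('C(#|bridgesC G| + #|bridgesB G|, 2)%:Z
       - \sum_(v : G | (3 <= deg v)%N) 'C(bridge_count v, 2)%:Z
       - 3 * \sum_(v : G | (4 <= deg v)%N) 'C(deg v, 4)%:Z).
Proof.
have legalE : #|legal_pairs G|%:Z = 'C(#|bridgesC G| + #|bridgesB G|, 2)%:Z
    - \sum_(v : G | (3 <= deg v)%N) 'C(bridge_count v, 2)%:Z.
  rewrite -!natz card_legal_pairs card_bridgesCB // [in RHS]big_mkcond /=.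
  congr (_ - _); apply: eq_bigr => v _; rewrite -natz bridge_countE.
  (* A vertex of degree 2 has a single bridge, hence no pair of bridges. *)
  have := hdeg v; rewrite leq_eqVlt => /predU1P[<- // | ->] //.
split; last by rewrite legalE.
have deg_gt0 (v : G) : (0 < deg v)%N by exact: ltnW (hdeg v).
rewrite (bartholdi_coef4E ha deg_gt0) -natz card_legal_pairs.
rewrite card_vertex_bridges.
congr (_ * (_ - _ - 3 * _)).
  by apply: eq_bigr => v _; rewrite bridge_countE.
rewrite [RHS]big_mkcond; apply: eq_bigr => v _; rewrite -natz.
by case: ltnP => // lt_deg; rewrite bin_small.
Qed.
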